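(* Let $G$ be a graph of order $n\ge 6$. Then $$\sigma_1(G)\le \frac{27}{64}\cdot 2^n,$$ with equality if and only if $G\cong 3K_2\cup (n-6)K_1$, or $n\ge 8$ and $G\cong 4K_2\cup (n-8)K_1$.
   Context: Graphs are finite, simple and undirected; the order of a graph is its number of vertices. For a graph $G$, $\sigma_1(G)$ denotes the number of $1$-nearly independent vertex subsets of $G$, i.e. the number of subsets $I$ of the vertex set $V(G)$ such that the subgraph of $G$ induced by $I$ has exactly one edge. $aK_2\cup bK_1$ denotes the disjoint union of $a$ copies of the complete graph $K_2$ and $b$ isolated vertices. $G$ is not assumed connected. *)

(* Defs.v *)
From mathcomp Require Import all_boot all_order all_algebra.

Set Implicit Arguments.
Unset Strict Implicit.
Unset Printing Implicit Defensive.

Record sgraph := SGraph {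
  svertex :> finType;
  sedge : rel svertex;
  sedge_sym : symmetric sedge;
  sedge_irr : irreflexive sedge }.

Notation "x -- y" := (sedge x y) (at level 70, no associativity).

(* Edges are unordered pairs: x -- y and y -- x yield the same 2-set. *)
Definition edges (G : sgraph) : {set {set G}} :=
  [set [set p.1; p.2] | p : G * G & p.1 -- p.2].

Section Induced.
Variables (G : sgraph) (I : {set G}).

Definition induced_rel : rel {x : G | x \in I} := fun x y => val x -- val y.

Fact induced_sym : symmetric induced_rel.
Proof. by move=> x y; apply: sedge_sym. Qed.

Fact induced_irr : irreflexive induced_rel.
Proof. by move=> x; apply: sedge_irr. Qed.

Definition induced : sgraph := SGraph induced_sym induced_irr.

End Induced.

Definition near_independent (k : nat) (G : sgraph) (I : {set G}) : bool :=
  #|edges (induced I)| == k.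

Definition sigma (k : nat) (G : sgraph) : nat :=
  #|[set I : {set G} | near_independent k I]|.

Section Complete.
Variable n : nat.

Definition complete_rel : rel 'I_n := fun x y => x != y.

Fact complete_sym : symmetric complete_rel.
Proof. by move=> x y; apply/negb_inj; rewrite !negbK eq_sym. Qed.

Fact complete_irr : irreflexive complete_rel.
Proof. by move=> x; rewrite /complete_rel eqxx. Qed.

Definition complete : sgraph := SGraph complete_sym complete_irr.

End Complete.

Section DisjointUnion.
Variables G H : sgraph.

Definition union_rel : rel (G + H)%type := fun u v =>
  match u, v with
  | inl x, inl y => x -- y
  | inr x, inr y => x -- y
  | _, _ => false
  end.

Fact union_sym : symmetric union_rel.
Proof. by move=> [x|x] [y|y] //=; apply: sedge_sym. Qed.

Fact union_irr : irreflexive union_rel.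
Proof. by move=> [x|x] /=; apply: sedge_irr. Qed.

Definition disjoint_union : sgraph := SGraph union_sym union_irr.

End DisjointUnion.

Section Copies.
Variables (a : nat) (G : sgraph).

Definition copies_rel : rel ('I_a * G)%type := fun u v =>
  (u.1 == v.1) && (u.2 -- v.2).

Fact copies_sym : symmetric copies_rel.
Proof. by move=> u v; rewrite /copies_rel eq_sym sedge_sym. Qed.

Fact copies_irr : irreflexive copies_rel.
Proof. by move=> u; rewrite /copies_rel sedge_irr andbF. Qed.

(* The disjoint union of a copies of G; empty when a = 0. *)
Definition copies : sgraph := SGraph copies_sym copies_irr.

End Copies.

Definition isomorphic (G H : sgraph) : Prop :=
  exists2 f : G -> H, bijective f & forall x y, (f x -- f y) = (x -- y).

Definition aK2_bK1 (a b : nat) : sgraph :=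
  disjoint_union (copies a (complete 2)) (copies b (complete 1)).

(* Main.v *)
(** Write [s0] and [s1] for the proportions of vertex subsets inducing no edge
and exactly one edge.  Adding a [K2] component turns [s1 + t s0] into
[3/4 (s1 + (t + 1/3) s0)], so a bound [s1 <= 27/64] valid for all graphs amounts
to [s1 <= 27/64], [s1 + s0/3 <= 9/16] and [s1 + 2 s0/3 <= 3/4], the further
iterates following from [s1 + s0 <= 1].  These three bounds are proved together
by induction, deleting a vertex of degree at least 2 if there is one; the first
is then strict.  Hence an extremal graph is a matching with [m] edges, for which
[s1 = m/3 (3/4)^m], and this equals 27/64 only for [m = 3] and [m = 4]. *)
Require Import Defs.
From mathcomp Require Import all_boot all_order all_algebra.
From mathcomp Require Import zify.

Set Implicit Arguments.
Unset Strict Implicit.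
Unset Printing Implicit Defensive.

(** * Edges inside vertex subsets *)

Definition nbh (G : sgraph) (v : G) : {set G} := [set u | v -- u].

Definition nedges (G : sgraph) (I : {set G}) : nat :=
  #|[set E in edges G | E \subset I]|.

(** The count is taken inside an ambient set [A] of a fixed graph, so that deleting vertices never
    changes the vertex type. *)
Definition nsub (G : sgraph) (k : nat) (A : {set G}) : nat :=
  #|[set I : {set G} | (I \subset A) && (nedges I == k)]|.

Section Counting.
Variable G : sgraph.
Implicit Types (u v x y : G) (A B H I J : {set G}) (k : nat).

Lemma in_nbh v u : (u \in nbh v) = (v -- u).
Proof. by rewrite inE. Qed.

Lemma edgesP (E : {set G}) :
  reflect (exists x y, x -- y /\ E = [set x; y]) (E \in edges G).
Proof.
apply: (iffP imsetP) => [[[x y] /=]|[x [y [xy ->]]]].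
  by rewrite inE /= => xy ->; exists x, y.
by exists (x, y); rewrite ?inE.
Qed.

(** Taking images under [val] is injective on vertex sets and carries the edges of the induced
    subgraph onto the edges of [G] contained in [I]. *)
Lemma card_edges_induced I : #|edges (induced I)| = nedges I.
Proof.
pose f (E : {set induced I}) : {set G} := val @: E.
have f_inj : injective f by apply/imset_inj/val_inj.
rewrite -(card_imset _ f_inj) /nedges; apply: eq_card => E; rewrite !inE.
apply/imsetP/andP => [[E0 /imsetP[[x y]] /=]|[/edgesP[x [y [xy ->]]] sub]].
  rewrite inE /= => xy -> ->; rewrite /f imsetU !imset_set1; split.
    by apply/edgesP; exists (val x), (val y).
  by rewrite subUset !sub1set (valP x) (valP y).
move: sub; rewrite subUset !sub1set => /andP[xI yI].
exists [set (exist _ x xI : induced I); exist _ y yI].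
  by apply/imsetP; exists (exist _ x xI, exist _ y yI); rewrite ?inE.
by rewrite /f imsetU !imset_set1.
Qed.

Lemma sigmaE k : sigma k G = nsub k [set: G].
Proof.
apply: eq_card => I.
by rewrite !inE subsetT /near_independent card_edges_induced.
Qed.

(** The edges avoiding [v] are those inside [I]; the others are the pairs [[set v; u]] with [u] a
    neighbour of [v] in [I]. *)
Lemma nedgesU1 v I : v \notin I ->
  nedges (v |: I) = nedges I + #|nbh v :&: I|.
Proof.
move=> vI; rewrite /nedges.
rewrite -(cardsID [set E : {set G} | v \in E]) addnC; congr (_ + _).
  apply: eq_card => E; rewrite !inE.
  case: (boolP (v \in E)) => vE /=.
    by apply/esym/negbTE; rewrite negb_and orbC; apply/orP; left;
       apply: contra vI => /subsetP/(_ v vE).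
  congr (_ && _); apply/subsetP/subsetP => sub x xE; last first.
    by rewrite !inE sub ?orbT.
  by have:= sub x xE; rewrite !inE => /predU1P[xv|//]; rewrite -xv xE in vE.
rewrite -(@card_in_imset _ _ (fun u => [set v; u])); last first.
  move=> x y; rewrite !inE => /andP[vx _] /andP[vy _] /setP/(_ x).
  rewrite !inE eqxx orbT => /esym/predU1P[xv|/eqP//].
  by rewrite xv sedge_irr in vx.
apply: eq_card => E; rewrite !inE; apply/idP/imsetP.
  case/andP=> /andP[/edgesP[x [y [xy ->]]]].
  rewrite subUset !sub1set !inE => /andP[xvI yvI] vxy.
  have [vx|vx] := eqVneq v x.
    subst x; exists y; rewrite // !inE xy.
    by case/predU1P: yvI => // yv; rewrite yv sedge_irr in xy.
  move: vxy; rewrite (negbTE vx) /= => /eqP vy; subst y.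
  exists x; last by rewrite setUC.
  rewrite !inE sedge_sym xy.
  by case/predU1P: xvI => // xv; rewrite xv eqxx in vx.
case=> u; rewrite !inE => /andP[vu uI] ->.
rewrite subUset !sub1set !inE !eqxx uI !orbT !andbT.
by apply/edgesP; exists v, u.
Qed.

Lemma nedges0 : nedges (set0 : {set G}) = 0.
Proof.
apply: eq_card0 => E; rewrite !inE subset0; apply/negP => /andP[/edgesP].
by case=> x [y [_ ->]] /eqP/setP/(_ x); rewrite !inE eqxx.
Qed.

(** * Recurrences for adding a vertex *)

Lemma card_subsets_with v B (P : pred {set G}) : v \notin B ->
  #|[set J : {set G} | [&& J \subset v |: B, v \in J & P J]]| =
  #|[set K : {set G} | (K \subset B) && P (v |: K)]|.
Proof.
move=> vB; rewrite -[RHS](@card_in_imset _ _ (fun K => v |: K)); last first.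
  move=> K L; rewrite !inE => /andP[sK _] /andP[sL _].
  have vK : v \notin K by apply: contra vB => /(subsetP sK).
  have vL : v \notin L by apply: contra vB => /(subsetP sL).
  by move/(congr1 (fun X => X :\ v)); rewrite !setU1K.
apply: eq_card => J; rewrite !inE; apply/and3P/imsetP => [[sJ vJ PJ]|[K]].
  exists (J :\ v); last by rewrite setD1K.
  by rewrite !inE setD1K // PJ subDset sJ.
rewrite !inE => /andP[sK PK] ->; rewrite PK setU11.
by split; rewrite // setUS.
Qed.

Lemma nsubU1_split k v B : v \notin B ->
  nsub k (v |: B) = nsub k B +
  #|[set J : {set G} | (J \subset B) && (nedges J + #|nbh v :&: J| == k)]|.
Proof.
move=> vB; rewrite /nsub -(cardsID [set J : {set G} | v \in J]) addnC.
congr (_ + _).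
  apply: eq_card => J; rewrite !inE.
  case: (boolP (v \in J)) => vJ /=.
    by apply/esym/negbTE; apply: contra vB => /andP[/subsetP/(_ v vJ)].
  congr (_ && _); apply/subsetP/subsetP => sub x xJ; last first.
    by rewrite !inE sub ?orbT.
  by have:= sub x xJ; rewrite !inE => /predU1P[xv|//]; rewrite -xv xJ in vJ.
transitivity #|[set J : {set G} |
    [&& J \subset v |: B, v \in J & nedges J == k]]|.
  by apply: eq_card => J; rewrite !inE -andbA [X in _ && X]andbC.
rewrite card_subsets_with //; apply: eq_card => K; rewrite !inE.
case: (boolP (K \subset B)) => //= sK; rewrite nedgesU1 //.
by apply: contra vB => /(subsetP sK).
Qed.

Lemma nsub0U1 v B : v \notin B ->
  nsub 0 (v |: B) = nsub 0 B + nsub 0 (B :\: nbh v).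
Proof.
move=> vB; rewrite nsubU1_split //; congr (_ + _); apply: eq_card => J.
rewrite !inE addn_eq0 cards_eq0 setI_eq0 subsetD [RHS]andbAC -andbA.
by rewrite disjoint_sym.
Qed.

(* [u] is the neighbour of [v] in the only edge when [v] belongs to it. *)
Lemma nsub1U1 v B : v \notin B ->
  nsub 1 (v |: B) = nsub 1 B + nsub 1 (B :\: nbh v) +
  \sum_(u in nbh v :&: B) nsub 0 (B :\: nbh v :\: nbh u).
Proof.
move=> vB; rewrite nsubU1_split // -addnA; congr (_ + _).
(* Either [J] misses [nbh v] and carries the edge itself, or [J] is independent and contains exactly
   one neighbour of [v]. *)
rewrite -(cardsID [set J : {set G} | nbh v :&: J == set0]); congr (_ + _).
  apply: eq_card => J; rewrite !inE subsetD disjoint_sym -setI_eq0.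
  case: (nbh v :&: J =P set0) => [->|_]; rewrite ?andbF //= ?andbT.
  by rewrite cards0 addn0.
set X := _ :\: _.
have X_E J : (J \in X) = [&& J \subset B, nedges J == 0 & #|nbh v :&: J| == 1].
  rewrite !inE -cards_eq0; case: (J \subset B); rewrite ?andbF //=.
  by case: (nedges J) => [|a]; case: #|_ :&: _| => [|[|b]]; rewrite ?addSn ?addnS.
rewrite -sum1_card.
(* Each [J] in [X] contains exactly one neighbour of [v], so its contribution 1 is a sum of
   indicators, and the two sums can be exchanged. *)
transitivity (\sum_(J in X) \sum_(u in nbh v :&: B) (u \in J : nat)).
  apply: eq_bigr => J; rewrite X_E => /and3P[sJ _ /cards1P[u NJ]].
  rewrite -big_mkcondr /= sum1_card -(cards1 u) -NJ; apply: eq_card => x.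
  rewrite [RHS]unfold_in !inE; case: (boolP (x \in J)); rewrite ?andbF // => xJ.
  by rewrite (subsetP sJ) ?andbT.
rewrite exchange_big /=; apply: eq_bigr => u; rewrite inE => /andP[uv uB].
rewrite -big_mkcondr sum1_card.
have uH : u \notin B :\: nbh v by rewrite inE uv.
(* Once [u] is in [J], having a single neighbour of [v] means that the rest of [J] lies outside
   [nbh v]. *)
transitivity #|[set J : {set G} |
    [&& J \subset u |: (B :\: nbh v), u \in J & nedges J == 0]]|.
  apply: eq_card => J; rewrite [LHS]inE X_E inE.
  case: (boolP (u \in J)); rewrite ?andbF //= andbT => uJ.
  case: (nedges J == 0); rewrite ?andbF //= andbT.
  apply/andP/subsetP => [[sJ /cards1P[w NJ]] x xJ|sub].
    have /setP/(_ u) := NJ; rewrite !inE -in_nbh uv uJ => /esym/eqP uw.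
    have /setP/(_ x) := NJ; rewrite !inE xJ andbT -uw => ->.
    by rewrite (subsetP sJ) //; case: (x == u).
  split.
    by apply/subsetP => x /sub; rewrite !inE => /predU1P[->//|/andP[]].
  apply/cards1P; exists u; apply/setP => x; rewrite !inE.
  apply/andP/eqP => [[vx /sub]|->]; last by rewrite -in_nbh.
  by rewrite !inE vx => /predU1P[].
rewrite card_subsets_with //; apply: eq_card => K; rewrite !inE.
rewrite [in RHS]subsetD -andbA; case: (boolP (K \subset _)) => //= sK.
rewrite nedgesU1; last by apply: contra uH => /(subsetP sK).
by rewrite addn_eq0 cards_eq0 setI_eq0 andbC disjoint_sym.
Qed.

Lemma nsub0_le A B : A \subset B -> nsub 0 A <= nsub 0 B.
Proof.
move=> sAB; apply/subset_leq_card/subsetP => I; rewrite !inE => /andP[sI ->].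
by rewrite (subset_trans sI).
Qed.

Lemma nsub01_le A : nsub 1 A + nsub 0 A <= 2 ^ #|A|.
Proof.
rewrite /nsub -cardsUI -card_powerset.
set X := _ :&: _; have -> : X = set0.
  by apply/setP => I; rewrite !inE; case: (nedges I) => [|[|m]]; rewrite !andbF.
rewrite cards0 addn0; apply/subset_leq_card/subsetP => I.
by rewrite !inE => /orP[] /andP[].
Qed.

Lemma nsub_set0 k : nsub k (set0 : {set G}) = (k == 0).
Proof.
rewrite /nsub; case: (eqVneq k 0) => [->|k0].
  transitivity #|[set (set0 : {set G})]|; last by rewrite cards1.
  apply: eq_card => I; rewrite !inE subset0.
  by case: eqP => // ->; rewrite nedges0.
apply: eq_card0 => I; rewrite !inE subset0.
by apply/negP => /andP[/eqP->]; rewrite nedges0 eq_sym (negbTE k0).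
Qed.

Lemma nsub_isolated k v B : v \notin B -> nbh v :&: B = set0 ->
  nsub k (v |: B) = 2 * nsub k B.
Proof.
move=> vB NB; rewrite nsubU1_split // mul2n -addnn; congr (_ + _).
apply: eq_card => J; rewrite !inE; case: (boolP (J \subset B)) => //= sJ.
have -> : nbh v :&: J = set0.
  by apply/eqP; rewrite -subset0 -NB setIS.
by rewrite cards0 addn0.
Qed.

(** * Components consisting of one edge *)

Section EdgeComponent.
Variables (v u : G) (H : {set G}).
Hypotheses (vH : v \notin H) (uH : u \notin H) (vu : v -- u).
Hypotheses (Nv : nbh v :&: H = set0) (Nu : nbh u :&: H = set0).

Let v_uH : v \notin u |: H.
Proof.
by rewrite !inE negb_or vH andbT; apply: contraTneq vu => ->; rewrite sedge_irr.
Qed.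

Let setD_nbhv : (u |: H) :\: nbh v = H.
Proof.
apply/setP => x; rewrite !inE; have /setP/(_ x) := Nv; rewrite !inE.
by have [->|xu] := eqVneq x u; rewrite ?vu ?(negbTE uH) //=; case: (v -- x).
Qed.

Let setI_nbhv : nbh v :&: (u |: H) = [set u].
Proof.
apply/setP => x; rewrite !inE; have /setP/(_ x) := Nv; rewrite !inE.
by have [->|xu] := eqVneq x u; rewrite ?vu.
Qed.

Lemma nsub0_edge : nsub 0 (v |: (u |: H)) = 3 * nsub 0 H.
Proof. by rewrite nsub0U1 // nsub_isolated // setD_nbhv; lia. Qed.

(** Of the four subsets of the two ends, three induce no edge; the fourth supplies the only edge and
    leaves an independent set in [H]. *)
Lemma nsub1_edge : nsub 1 (v |: (u |: H)) = 3 * nsub 1 H + nsub 0 H.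
Proof.
rewrite nsub1U1 // nsub_isolated // setD_nbhv setI_nbhv big_set1.
have -> : H :\: nbh u = H by apply/setDidPl; rewrite disjoint_sym -setI_eq0 Nu.
by lia.
Qed.

End EdgeComponent.

(** * The three bounds *)

(* [27/64 (4/3)^k] bounds the proportion of [s1 + k/3 s0] for [k = 0, 1, 2]. *)
Definition near_bounds A : bool :=
  [&& 64 * nsub 1 A <= 27 * 2 ^ #|A|,
      16 * (3 * nsub 1 A + nsub 0 A) <= 27 * 2 ^ #|A| &
      4 * (3 * nsub 1 A + 2 * nsub 0 A) <= 9 * 2 ^ #|A|].

(** If [v] has [d >= 3] neighbours and [h] non-neighbours in [B], at most [d 2^h] one-edge sets
    contain [v]; the inequality puts this strictly below [27/64 2^(d+h)]. It fails for [d = 2],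
    which needs a finer count. *)
Lemma deg3_exp d : 3 <= d -> 64 * d + 1 <= 27 * 2 ^ d.
Proof.
elim: d => // d IH; rewrite leq_eqVlt => /predU1P[[<-]//|d3].
by rewrite expnS; have := IH d3; lia.
Qed.

(** The sets avoiding [v] are governed by [B], those containing it by [H] and the sum [T] over the
    neighbours of [v]. Strictness in the first bound later excludes such a vertex from extremal
    graphs. *)
Lemma near_bounds_step_deg2 v B : v \notin B -> 2 <= #|nbh v :&: B| ->
    (forall A, A \subset B -> near_bounds A) ->
  near_bounds (v |: B) /\ 64 * nsub 1 (v |: B) < 27 * 2 ^ #|v |: B|.
Proof.
move=> vB d2 IH; have IHB := IH B (subxx B).
set N := nbh v :&: B in d2; set H := B :\: nbh v.
have sHB : H \subset B by rewrite subsetDl.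
have IHH := IH H sHB.
have cB : #|B| = #|N| + #|H| by rewrite -(cardsID (nbh v) B) setIC.
have cA : #|v |: B| = #|B|.+1 by rewrite cardsU1 vB.
have Q_le u : nsub 0 (H :\: nbh u) <= nsub 0 H by rewrite nsub0_le ?subsetDl.
have le1 := nsub01_le H.
have N_H u : u \in N -> u \notin H by rewrite !inE => /andP[->].
move: IHB IHH; rewrite /near_bounds cA expnS cB !expnD.
rewrite nsub0U1 // nsub1U1 // -/N -/H.
set T := \sum_(u in N) _.
have T_le : T <= #|N| * nsub 0 H.
  by rewrite -sum_nat_const leq_sum.
move=> /and3P[b0 b1 b2] /and3P[h0 h1 h2].
have [d3|] := leqP 3 #|N|.
  have T_H : nsub 1 H + T <= #|N| * 2 ^ #|H|.
    apply: leq_trans (_ : #|N| * (nsub 1 H + nsub 0 H) <= _); last first.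
      by rewrite leq_mul2l le1 orbT.
    by rewrite mulnDr leq_add // leq_pmull // (leq_trans _ d3).
  have := leq_mul d3 (leqnn (2 ^ #|H|)).
  have := leq_mul (deg3_exp d3) (leqnn (2 ^ #|H|)).
  (* With [Z] for [#|N| * 2 ^ #|H|] and [W] for [2 ^ #|N| * 2 ^ #|H|], the goals become linear. *)
  clearbody T; rewrite mulnDl mul1n -!mulnA; move: T_H b0 b1 b2 (expn_gt0 2 #|H|) => /=.
  move: (#|N| * _) (2 ^ #|N| * _) => Z W T_H b0 b1 b2 X0 ZX WZ.
  by split; [apply/and3P; split|]; lia.
rewrite ltnS => d_le2; have d_eq : #|N| = 2 by apply/eqP; rewrite eqn_leq d_le2.
have X0 := expn_gt0 2 #|H|.
(* If a neighbour of [v] has a neighbour in [H], at most half of the subsets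
   of [H] avoid it; otherwise [v] and [N] form a component [P3] or [K3]. *)
case: (boolP [exists u in N, nbh u :&: H != set0]) => [/exists_inP[u uN Nu]|].
  have cu : #|H| = #|nbh u :&: H| + #|H :\: nbh u|.
    by rewrite -(cardsID (nbh u) H) setIC.
  have: 2 * nsub 0 (H :\: nbh u) <= 2 ^ #|H|.
    rewrite cu expnD leq_mul //.
      by rewrite -{1}(expn1 2) leq_exp2l // card_gt0.
    by have := nsub01_le (H :\: nbh u); lia.
  have: T <= nsub 0 (H :\: nbh u) + nsub 0 H.
    rewrite /T (bigD1 u) //= leq_add2l.
    apply: leq_trans (_ : \sum_(i in N | i != u) nsub 0 H <= _).
      by apply: leq_sum.
    rewrite sum_nat_const -[X in _ <= X]mul1n leq_mul //.
    have -> : #|[pred i in N | i != u]| = #|N :\ u|.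
      by apply: eq_card => i; rewrite !inE andbC.
    by have := cardsD1 u N; rewrite uN d_eq; lia.
  (* In units of [2 ^ #|H|], the one-edge sets containing [v] number at most 1 + 1/2, and 64 * 3/2 =
     96 < 27 * 4. *)
  move=> T_Q Q_X; rewrite d_eq -[2 ^ 2]/4 in b0 b1 b2 *; clearbody T; by split; [apply/and3P; split|]; lia.
rewrite negb_exists => /forallP noN.
have {}noN u : u \in N -> nbh u :&: H = set0.
  by move=> uN; have := noN u; rewrite uN /= negbK => /eqP.
have /cards2P[x [y [xy N_E]]] : #|N| == 2 by rewrite d_eq.
have xN : x \in N by rewrite N_E !inE eqxx.
have yN : y \in N by rewrite N_E !inE eqxx orbT.
have B_E : B = x |: (y |: H).
  by rewrite setUA -N_E /N setIC setID.
have T_eq : T = 2 * nsub 0 H.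
  rewrite -d_eq -sum_nat_const; apply: eq_bigr => u uN; congr (nsub 0 _).
  by apply/setDidPl; rewrite disjoint_sym -setI_eq0 noN.
rewrite d_eq -[2 ^ 2]/4 T_eq [in nsub 0 B]B_E [in nsub 1 B]B_E.
(* For [K3] the count is [4 s1 + 3 s0] in terms of [H]; [h2] and [le1] bound it by 9/4 + 1 < 27/8
   times [2 ^ #|H|]. *)
case: (boolP (x -- y)) => [xy_edge|xy_nedge].
  rewrite nsub0_edge ?nsub1_edge ?N_H ?noN //.
  by split; [apply/and3P; split|]; lia.
(* For [P3] the count is [5 s1 + 2 s0]; [h2] and [h0] bound it by 9/4 + 27/32 < 27/8 times
   [2 ^ #|H|]. *)
have Ny : nbh x :&: (y |: H) = set0.
  by rewrite setIUr noN // setU0; apply/eqP;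
     rewrite setIC setI_eq0 disjoints1 in_nbh.
have xH : x \notin y |: H by rewrite !in_setU1 negb_or xy N_H.
rewrite !(nsub_isolated _ xH Ny) !(nsub_isolated _ (N_H y yN) (noN y yN)).
by split; [apply/and3P; split|]; lia.
Qed.

(** Strong induction on the size of [A]. When no vertex has two neighbours inside [A], any chosen
    vertex is isolated in [A], which doubles all counts, or is an end of a [K2] component. *)
Lemma near_boundsP A : near_bounds A.
Proof.
have [n] := ubnP #|A|; elim: n A => // n IH A; rewrite ltnS => leAn.
have [->|[v vA]] := set_0Vmem A.
  by rewrite /near_bounds !nsub_set0 cards0.
suff IHn B : B \proper A -> near_bounds B; last first.
  by move=> /proper_card ltB; apply/IH/(leq_trans ltB).
case: (boolP [exists w in A, 2 <= #|nbh w :&: (A :\ w)|]) => [|le1].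
  case/exists_inP=> w wA d2; rewrite -(setD1K wA).
  have wB : w \notin A :\ w by rewrite !inE eqxx.
  apply: (near_bounds_step_deg2 wB d2 _).1 => B sB.
  by apply/IHn/(sub_proper_trans sB)/properD1.
have {}le1 w : w \in A -> #|nbh w :&: (A :\ w)| <= 1.
  move=> wA; rewrite leqNgt; apply: contra le1 => d2.
  by apply/exists_inP; exists w.
have vB : v \notin A :\ v by rewrite !inE eqxx.
have [Nv0|[u uNv]] := set_0Vmem (nbh v :&: (A :\ v)).
  rewrite -(setD1K vA); have := IHn _ (properD1 vA).
  rewrite /near_bounds !nsub_isolated // cardsU1 vB expnS.
  by move=> /and3P[b0 b1 b2]; apply/and3P; split; lia.
have /and3P[vu uv uA] : [&& v -- u, u != v & u \in A].
  by move: uNv; rewrite !inE.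
set H := A :\ v :\ u.
have A_E : A = v |: (u |: H) by rewrite !setD1K // !inE uv.
have vH : v \notin H by rewrite !inE eqxx andbF.
have uH : u \notin H by rewrite !inE eqxx.
(* The neighbour [x] of [w] outside [H] is its only neighbour in [A], so [w] has none in [H]. *)
have noN w x y : x \notin H -> w \in A -> x \in nbh w :&: (A :\ w) ->
    y \in nbh w -> y \in H -> w != y -> False.
  move=> xH wA xN yN yH wy; have /card_le1_eqP/(_ x y xN) := le1 w wA.
  have yN' : y \in nbh w :&: (A :\ w).
    by move: yN yH; rewrite !inE => -> /and3P[_ _ ->]; rewrite eq_sym wy.
  by move=> /(_ yN') xy; rewrite -xy yH in xH.
have Nv : nbh v :&: H = set0.
  apply/eqP; apply: contraT => /set0Pn[y /setIP[yN yH]].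
  case: (noN v u y uH vA uNv yN yH).
  by apply: contraNneq vH => ->.
have Nu : nbh u :&: H = set0.
  apply/eqP; apply: contraT => /set0Pn[y /setIP[yN yH]].
  case: (noN u v y vH uA _ yN yH).
    by rewrite !inE sedge_sym vu eq_sym uv.
  by apply: contraNneq uH => ->.
have /and3P[] : near_bounds H.
  by apply/IHn/(sub_proper_trans _ (properD1 vA)); rewrite subsetDl.
have := nsub01_le H.
rewrite A_E /near_bounds nsub0_edge ?nsub1_edge //.
have -> : #|v |: (u |: H)| = #|H|.+2.
  by rewrite -A_E (cardsD1 v A) vA (cardsD1 u (A :\ v)) !inE uv uA.
by rewrite !expnS => b3 b0 b1 b2; apply/and3P; split; lia.
Qed.

(** * Counting in matchings *)

(** The default is [x] itself, so an isolated vertex is not adjacent to its mate. *)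
Definition mate x : G := odflt x [pick y | x -- y].

(* One end of every edge, picked by the enumeration order of [G]. *)
Definition reps : {set G} :=
  [set x | (x -- mate x) && (enum_rank x < enum_rank (mate x))].

Definition nonisolated : {set G} := [set x | nbh x != set0].

Lemma nonisolatedP x : reflect (exists y, x -- y) (x \in nonisolated).
Proof.
rewrite inE; apply: (iffP (set0Pn _)) => -[y xy]; exists y.
  by rewrite in_nbh in xy.
by rewrite in_nbh.
Qed.

Lemma mate_edge x : x \in nonisolated -> x -- mate x.
Proof.
by case/nonisolatedP => y xy; rewrite /mate; case: pickP => [//|/(_ y)]; rewrite xy.
Qed.

End Counting.

Definition matching (G : sgraph) : Prop :=
  forall x y z : G, x -- y -> x -- z -> y = z.

Lemma matching_or_deg2 (G : sgraph) :
  matching G \/ exists v : G, 2 <= #|nbh v|.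
Proof.
case: (boolP [exists v : G, 2 <= #|nbh v|]) => [/existsP|noN]; [by right|left].
move=> x y z xy xz; have : #|nbh x| <= 1.
  by rewrite leqNgt; apply: contra noN => ?; apply/existsP; exists x.
by move/card_le1_eqP; apply; rewrite in_nbh.
Qed.

Section Matching.
Variable G : sgraph.
Hypothesis matchG : matching G.
Implicit Types (x y u v : G) (A : {set G}).

Lemma mateE x y : x -- y -> mate x = y.
Proof.
by move=> xy; apply: (matchG (mate_edge _) xy); apply/nonisolatedP; exists y.
Qed.

Lemma in_reps x y : x -- y -> (x \in reps G) = (enum_rank x < enum_rank y).
Proof. by move=> xy; rewrite inE (mateE xy) xy. Qed.

Lemma repsN x y : x -- y -> (y \in reps G) = (x \notin reps G).
Proof.
move=> xy; rewrite (in_reps xy) -leqNgt leq_eqVlt (@in_reps y x) 1?sedge_sym //.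
case: eqP => // /val_inj/enum_rank_inj yx.
by rewrite yx sedge_irr in xy.
Qed.

(** Induction removing an isolated vertex or a whole [K2]; either removal keeps the set closed under
    adjacency. Cleared of denominators, the proportions are [(3/4)^m] and [m/3 (3/4)^m]. *)
Lemma matching_count A : (forall x y, x \in A -> x -- y -> y \in A) ->
  let m := #|reps G :&: A| in
  [/\ #|nonisolated G :&: A| = 2 * m,
      nsub 0 A * 4 ^ m = 3 ^ m * 2 ^ #|A| &
      3 * nsub 1 A * 4 ^ m = m * 3 ^ m * 2 ^ #|A|].
Proof.
have [n] := ubnP #|A|; elim: n A => // n IH A; rewrite ltnS => leAn closedA /=.
have [->|[v vA]] := set_0Vmem A.
  by rewrite !setI0 cards0 !nsub_set0.
have vB : v \notin A :\ v by rewrite !inE eqxx.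
have card_setI (S : {set G}) (w : G) (B : {set G}) : w \in B ->
    #|S :&: B| = (w \in S) + #|S :&: (B :\ w)|.
  by move=> wB; rewrite (cardsD1 w) inE wB andbT setIDA.
case: (boolP (v \in nonisolated G)) => [/nonisolatedP[u vu]|vi]; last first.
  have noN x : v -- x = false.
    by apply: contraNF vi => vx; apply/nonisolatedP; exists x.
  have Nv : nbh v :&: (A :\ v) = set0.
    by apply/setP => x; rewrite !inE noN.
  have closedB x y : x \in A :\ v -> x -- y -> y \in A :\ v.
    rewrite !inE => /andP[_ xA] xy; rewrite (closedA x) // andbT.
    by apply: contraTneq xy => ->; rewrite sedge_sym noN.
  have ltB : #|A :\ v| < n by rewrite (leq_trans _ leAn) // (cardsD1 v A) vA.
  have [IH1 IH2 IH3] := IH _ ltB closedB.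
  have vr : v \notin reps G by rewrite inE noN.
  rewrite !(card_setI _ v A vA) (negbTE vi) (negbTE vr) !add0n.
  have nsub_A k : nsub k A = 2 * nsub k (A :\ v).
    by rewrite -{1}(setD1K vA) nsub_isolated.
  rewrite !nsub_A (cardsD1 v A) vA expnS; move: IH2 IH3.
  by move: (4 ^ _) (3 ^ _) (2 ^ _) => f t w IH2 IH3; split=> //; nia.
have uv : u -- v by rewrite sedge_sym.
have u_neq_v : u != v by apply: contraTneq uv => ->; rewrite sedge_irr.
have uA : u \in A :\ v by rewrite !inE u_neq_v (closedA v).
set H := A :\ v :\ u.
have vH : v \notin H by rewrite !inE eqxx andbF.
have uH : u \notin H by rewrite !inE eqxx.
have closedH x y : x \in H -> x -- y -> y \in H.
  rewrite !inE => /and3P[xu xv xA] xy; rewrite (closedA x) // andbT.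
  apply/andP; split.
    apply: contraNneq xv => yu; apply/eqP.
    by apply: matchG uv; rewrite sedge_sym -yu.
  apply: contraNneq xu => yv; apply/eqP.
  by apply: matchG vu; rewrite sedge_sym -yv.
have A_E : A = v |: (u |: H) by rewrite !setD1K.
have cA : #|A| = #|H|.+2 by rewrite (cardsD1 v) vA (cardsD1 u) uA.
have ltH : #|H| < n by rewrite cA in leAn; lia.
have [IH1 IH2 IH3] := IH _ ltH closedH.
have Nv : nbh v :&: H = set0.
  apply/setP => x; rewrite !in_setI in_nbh in_set0; apply/negP => /andP[vx xH].
  by rewrite (matchG vu vx) xH in uH.
have Nu : nbh u :&: H = set0.
  apply/setP => x; rewrite !in_setI in_nbh in_set0; apply/negP => /andP[ux xH].
  by rewrite (matchG uv ux) xH in vH.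
(* Exactly one of [v] and [u] is a representative, by [repsN]. *)
have m_E : #|reps G :&: A| = #|reps G :&: H|.+1.
  rewrite (card_setI _ v) // (card_setI _ u) // addnA (repsN vu).
  by case: (v \in reps G).
have M_E : #|nonisolated G :&: A| = #|nonisolated G :&: H|.+2.
  rewrite (card_setI _ v) // (card_setI _ u) //.
  have -> : v \in nonisolated G by apply/nonisolatedP; exists u.
  by have -> : u \in nonisolated G by apply/nonisolatedP; exists v.
rewrite M_E m_E cA A_E nsub0_edge // nsub1_edge // IH1 !expnS.
move: IH2 IH3; set m := #|reps G :&: H|; move: (4 ^ m) (3 ^ m) (2 ^ _).
by move=> f t w IH2 IH3; split; nia.
Qed.

Lemma card_nonisolated : #|nonisolated G| = 2 * #|reps G|.
Proof.
have [//|] := @matching_count [set: G] _.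
by rewrite !setIT.
Qed.

Lemma sigma1_matching :
  3 * sigma 1 G * 4 ^ #|reps G| = #|reps G| * 3 ^ #|reps G| * 2 ^ #|G|.
Proof.
have [//|_ _] := @matching_count [set: G] _.
by rewrite !setIT cardsT sigmaE.
Qed.

(** * Matchings as disjoint unions of copies of [K2] and [K1] *)

Let K := aK2_bK1 #|reps G| #|~: nonisolated G|.

(** Going from the model to [G] uses the enumerations directly; the isomorphism out of [G] is then
    the inverse given by bijectivity. *)
Definition of_aK2_bK1 (p : K) : G :=
  match p with
  | inl (i, j) => if j == ord0 then enum_val i else mate (enum_val i)
  | inr (i, _) => enum_val i
  end.

Lemma aK2_bK1_matching a b : matching (aK2_bK1 a b).
Proof.
move=> [[i j]|[i j]] [[i1 j1]|[i1 j1]] [[i2 j2]|[i2 j2]] //=;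
  rewrite /copies_rel /= /complete_rel.
  case/andP=> /eqP<- jj1 /andP[/eqP<- jj2]; congr (inl (_, _)).
  by apply: val_inj; case: j j1 j2 jj1 jj2 => [[|[]]] // ? [[|[]]] // ? [[|[]]].
by rewrite !ord1 eqxx andbF.
Qed.

Lemma of_aK2_bK1_edge (p q : K) :
  (of_aK2_bK1 p -- of_aK2_bK1 q) = (p -- q).
Proof.
have rep_edge (i : 'I_#|reps G|) : enum_val i -- mate (enum_val i).
  by have := enum_valP i; rewrite inE => /andP[].
have mate_rep (i : 'I_#|reps G|) : mate (enum_val i) \notin reps G.
  by rewrite (repsN (rep_edge i)) negbK enum_valP.
have rep_rep (i i' : 'I_#|reps G|) : enum_val i -- enum_val i' = false.
  apply/negP => /mateE mi; have := mate_rep i.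
  by rewrite mi enum_valP.
have rep_mate (i i' : 'I_#|reps G|) :
    (enum_val i -- mate (enum_val i')) = (i == i').
  apply/idP/eqP => [ii'|<-//]; apply/enum_val_inj.
  by apply: (@matchG (mate (enum_val i'))); rewrite sedge_sym.
have mate_mate (i i' : 'I_#|reps G|) :
    mate (enum_val i) -- mate (enum_val i') = false.
  apply/negP => ii'; have := mate_rep i'.
  rewrite -(matchG _ ii' : enum_val i = _) ?enum_valP //.
  by rewrite sedge_sym.
have iso_edge (i : 'I_#|~: nonisolated G|) z : enum_val i -- z = false.
  apply/negP => iz; have := enum_valP i; rewrite inE => /negP[].
  by apply/nonisolatedP; exists z.
case: p q => [[i j]|[i j]] [[i' j']|[i' j']] /=;
  rewrite ?[in LHS]iso_edge // /copies_rel /= /complete_rel.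
- case: j j' => [[|[|//]] ?] [[|[|//]] ?] /=.
  + by rewrite rep_rep andbC.
  + by rewrite rep_mate andbT.
  + by rewrite sedge_sym rep_mate andbT eq_sym.
  + by rewrite mate_mate andbC.
- by rewrite sedge_sym iso_edge.
- by rewrite !ord1 eqxx andbF.
Qed.

(** The cardinalities agree, so injectivity suffices. A [K2] vertex has a neighbour [r]; a vertex
    with the same image is also adjacent to [r], hence equal to it because the model is a
    matching. *)
Lemma of_aK2_bK1_bij : bijective of_aK2_bK1.
Proof.
apply: inj_card_bij; last first.
  rewrite card_sum !card_prod !card_ord muln1 mulnC -card_nonisolated.
  by rewrite cardsC.
have inl_nbr i j : exists r : K, (inl (i, j) : K) -- r.
  exists (inl (i, if j == ord0 then ord_max else ord0)).
  by have [->|j0] := eqVneq j ord0; rewrite /= /copies_rel /= eqxx.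
have inl_inj i j (q : K) :
    of_aK2_bK1 (inl (i, j)) = of_aK2_bK1 q -> inl (i, j) = q.
  case: (inl_nbr i j) => r pr e; apply: (@aK2_bK1_matching _ _ r).
    by rewrite sedge_sym.
  by rewrite sedge_sym -of_aK2_bK1_edge -e of_aK2_bK1_edge.
move=> [[i j]|[i j]] q; first exact: inl_inj.
case: q => [[i' j']|[i' j']]; first by move=> e; apply/esym/inl_inj.
by move=> /enum_val_inj ->; rewrite !ord1.
Qed.

Lemma matching_isomorphic :
  isomorphic G (aK2_bK1 #|reps G| (#|G| - 2 * #|reps G|)).
Proof.
have -> : #|G| - 2 * #|reps G| = #|~: nonisolated G|.
  by rewrite -card_nonisolated -(cardsC (nonisolated G)) addKn.
have [f gK fK] := of_aK2_bK1_bij; exists f; first by exists of_aK2_bK1.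
by move=> x y; rewrite -of_aK2_bK1_edge !fK.
Qed.

End Matching.

(** The set [reps G] depends on an enumeration, so its size is recovered from the number of
    non-isolated vertices, which an isomorphism preserves. *)
Lemma isomorphic_aK2_bK1 (G : sgraph) a b : isomorphic G (aK2_bK1 a b) ->
  matching G /\ #|reps G| = a.
Proof.
case=> f f_bij f_edge; have f_inj := bij_inj f_bij.
have matchG : matching G.
  move=> x y z; rewrite -!f_edge => xy xz; apply: f_inj.
  exact: aK2_bK1_matching xy xz.
split=> //; suff: #|nonisolated G| = 2 * a by rewrite card_nonisolated //; lia.
rewrite -(card_imset _ f_inj).
transitivity #|[set (inl p : aK2_bK1 a b) | p : 'I_a * 'I_2]|; last first.
  by rewrite card_imset ?card_prod ?card_ord 1?mulnC // => p q [].
case: f_bij => g fK gK; apply: eq_card => x; apply/imsetP/imsetP.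
  case=> y /nonisolatedP[z yz] ->; move: yz; rewrite -f_edge.
  case: (f y) => [p|[i j]]; first by exists p.
  by case: (f z) => [//|[k l]]; rewrite /= /copies_rel /complete_rel !ord1 andbF.
case=> -[i j] _ ->; exists (g (inl (i, j))); last by rewrite gK.
apply/nonisolatedP; exists (g (inl (i, if j == ord0 then ord_max else ord0))).
rewrite -f_edge !gK /= /copies_rel /= eqxx /complete_rel.
by case: (eqVneq j ord0) => [->|].
Qed.

(** * The equality case *)

Lemma matching_ratio m : (64 * (m * 3 ^ m) == 81 * 4 ^ m) = (m == 3) || (m == 4).
Proof.
have [m5|] := leqP 5 m; last by case: m => [|[|[|[|[|]]]]].
have [-> ->] : (m == 3) = false /\ (m == 4) = false by lia.
(* At 5 the values are 77760 < 82944. Passing from [m] to [m + 1] multiplies the left side by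
   [3 (m + 1) / m], which is below 4, and the right side by 4. *)
apply/ltn_eqF; elim: m m5 => // m IH; rewrite leq_eqVlt => /predU1P[[<-]//|m5].
have := IH m5; rewrite !expnS; move: (3 ^ m) (4 ^ m) => t f; nia.
Qed.

Lemma sigma1_bound (G : sgraph) : 64 * sigma 1 G <= 27 * 2 ^ #|G|.
Proof. by rewrite sigmaE -cardsT; case/and3P: (near_boundsP [set: G]). Qed.

(** A vertex of degree at least 2, added back to the rest of the graph, would make the bound
    strict. *)
Lemma sigma1_extremal_matching (G : sgraph) :
  64 * sigma 1 G = 27 * 2 ^ #|G| -> matching G.
Proof.
move=> eqG; have [//|[v d2]] := matching_or_deg2 G.
have vB : v \notin [set: G] :\ v by rewrite !inE eqxx.
have Nv : nbh v :&: ([set: G] :\ v) = nbh v.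
  apply/setP => x; rewrite !inE andbT; case: eqP => [->|_]; rewrite ?andbT //.
  by rewrite sedge_irr.
rewrite -Nv in d2.
have [_] := near_bounds_step_deg2 vB d2 (fun A _ => near_boundsP A).
by rewrite setD1K ?inE // cardsT -sigmaE eqG ltnn.
Qed.

Lemma sigma1_extremal_reps (G : sgraph) : matching G ->
  64 * sigma 1 G = 27 * 2 ^ #|G| <-> #|reps G| = 3 \/ #|reps G| = 4.
Proof.
move=> matchG; have := sigma1_matching matchG.
have := matching_ratio #|reps G|; move: #|reps G| => m ratio formula.
have pos4 : 0 < 4 ^ m by rewrite expn_gt0.
have pos2 : 0 < 2 ^ #|G| by rewrite expn_gt0.
(* Both equations are compared through [formula], cancelling the positive factors [2 ^ #|G|] and
   [4 ^ m]. *)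
have -> : 64 * sigma 1 G = 27 * 2 ^ #|G| <-> 64 * (m * 3 ^ m) = 81 * 4 ^ m.
  move: (4 ^ m) (3 ^ m) (2 ^ _) (sigma 1 G) formula pos4 pos2 {ratio}.
  move=> f t w s formula pos4 pos2; split=> e; apply/eqP.
    by rewrite -(eqn_pmul2r pos2); apply/eqP; nia.
  by rewrite -(eqn_pmul2r pos4); apply/eqP; nia.
split=> [/eqP|]; first by rewrite ratio => /orP[]/eqP; [left|right].
by move=> m34; apply/eqP; rewrite ratio; case: m34 => ->.
Qed.

Theorem theorem5 (G : sgraph) (n : nat) (order_G : #|G| = n) (n_ge6 : 6 <= n) :
  ((sigma 1 G)%:R <= 27%:R / 64%:R * 2%:R ^+ n :> rat)%R /\
  (((sigma 1 G)%:R = 27%:R / 64%:R * 2%:R ^+ n :> rat)%R <->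
   isomorphic G (aK2_bK1 3 (n - 6)) \/
   (8 <= n /\ isomorphic G (aK2_bK1 4 (n - 8)))).
Proof.
have rhsE : (27%:R / 64%:R * 2%:R ^+ n = (27 * 2 ^ n)%:R / 64%:R :> rat)%R.
  by rewrite GRing.natrM GRing.natrX GRing.mulrAC.
rewrite {}rhsE; split.
  rewrite Num.Theory.ler_pdivlMr // -GRing.natrM Num.Theory.ler_nat mulnC.
  by rewrite -order_G sigma1_bound.
have -> : ((sigma 1 G)%:R = (27 * 2 ^ n)%:R / 64%:R :> rat)%R <->
    64 * sigma 1 G = 27 * 2 ^ #|G|.
  rewrite order_G [64 * _]mulnC; split=> [e|<-]; last by rewrite GRing.natrM GRing.mulfK.
  apply/eqP; rewrite -(Num.Theory.eqr_nat rat) GRing.natrM e.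
  by rewrite GRing.divfK.
split=> [eqG|].
  have matchG := sigma1_extremal_matching eqG.
  have iso := matching_isomorphic matchG; rewrite order_G in iso.
  (* This gives [2 * #|reps G| <= n], hence [8 <= n] in the case of four edges. *)
  have := max_card (mem (nonisolated G)).
  rewrite card_nonisolated // order_G.
  by case: ((sigma1_extremal_reps matchG).1 eqG) => m_E; rewrite m_E in iso *;
     [left|right].
by case=> [|[_]] /isomorphic_aK2_bK1[matchG m_E];
   apply/(sigma1_extremal_reps matchG); rewrite m_E; [left|right].
Qed.
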